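(* A quasi-Riordan array $[g,f]$ is a Riordan array (i.e. equals, as a matrix, $(g',f')$ for some $g'\in\mathcal{F}_0$ and $f'\in\mathcal{F}_1$) if and only if $f=tg$, in which case $[g,f]=(g,t)$. Consequently $\mathcal{A}_r:=\{[g,tg]: g\in\mathcal{F}_0,\ g(0)=1\}$ is a subgroup of the quasi-Riordan group $\mathcal{R}_r$.
   Context: $\mathbb{K}$ is $\mathbb{R}$ or $\mathbb{C}$; $\mathcal{F}_r$ denotes the set of formal power series in $\mathbb{K}[[t]]$ of order $r$. The Riordan array $(g,f)$, $g\in\mathcal{F}_0$, $f\in\mathcal{F}_1$, is the infinite lower triangular matrix whose $k$th column has generating function $gf^k$. For $g\in\mathcal{F}_0$ with $g(0)=1$ and $f\in\mathcal{F}_1$, the quasi-Riordan array $[g,f]$ is the infinite lower triangular matrix whose $0$th column has generating function $g$ and whose $j$th column, for $j\ge1$, has generating function $t^{j-1}f$. $\mathcal{R}_r$ is the set of all quasi-Riordan arrays, a group under matrix multiplication. *)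

(* Defs.v *)
From mathcomp Require Import all_boot all_order all_algebra.
From mathcomp Require Import all_classical all_reals.
From mathcomp Require Import complex.

Set Implicit Arguments.
Unset Strict Implicit.
Unset Printing Implicit Defensive.

Import GRing.Theory.

Local Open Scope classical_set_scope.
Local Open Scope ring_scope.

(* The two choices for the scalar field: the reals and the complex numbers. *)
Variant scalars := RealScalars | ComplexScalars.

Definition scalar_field (R : realType) (s : scalars) : fieldType :=
  match s with
  | RealScalars => R
  | ComplexScalars => complex R
  end.

Section PowerSeries.
Variable K : fieldType.

(* The series \sum_n a_n t^n is the function n |-> a_n; the product is the
   Cauchy product, not the pointwise product of functions. *)
Definition fps : Type := nat -> K.

Definition fps1 : fps := fun n => (n == 0)%:R.

Definition fpsX : fps := fun n => (n == 1)%:R.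

Definition fps_mul (a b : fps) : fps :=
  fun n => \sum_(i < n.+1) a i * b (n - i)%N.

Definition fps_exp (a : fps) (k : nat) : fps := iter k (fps_mul a) fps1.

(* The set F_r; the zero series has no (finite) order. *)
Definition fps_of_order (r : nat) : set fps :=
  [set a | (forall i, (i < r)%N -> a i = 0) /\ a r != 0].

End PowerSeries.

Section Arrays.
Variable K : fieldType.

(* M n k is the entry in row n and column k, both numbered from 0. *)
Definition array : Type := nat -> nat -> K.

(* The matrix product of lower triangular arrays: the terms A n j * B j k with
   j > n, omitted here, vanish when A is lower triangular. *)
Definition array_mul (A B : array) : array :=
  fun n k => \sum_(j < n.+1) A n j * B j k.

Definition riordan (g f : fps K) : array :=
  fun n k => fps_mul g (fps_exp f k) n.

Definition quasi_riordan (g f : fps K) : array :=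
  fun n k => match k with
             | 0%N => g n
             | j.+1 => fps_mul (fps_exp (@fpsX K) j) f n
             end.

Definition riordan_arrays : set array :=
  [set M | exists g f : fps K,
     [/\ fps_of_order 0 g, fps_of_order 1 f & M = riordan g f]].

(* The set R_r. *)
Definition quasi_riordan_arrays : set array :=
  [set M | exists g f : fps K,
     [/\ fps_of_order 0 g, g 0%N = 1, fps_of_order 1 f
       & M = quasi_riordan g f]].

(* The set A_r. *)
Definition quasi_appell_arrays : set array :=
  [set M | exists g : fps K,
     [/\ fps_of_order 0 g, g 0%N = 1
       & M = quasi_riordan g (fps_mul (@fpsX K) g)]].

End Arrays.

Definition is_group (T : Type) (op : T -> T -> T) (G : set T) : Prop :=
  [/\ forall x y, G x -> G y -> G (op x y),
      forall x y z, G x -> G y -> G z -> op x (op y z) = op (op x y) z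
    & exists e, [/\ G e,
        forall x, G x -> op e x = x /\ op x e = x
      & forall x, G x -> exists y, [/\ G y, op y x = e & op x y = e]]].

Definition is_subgroup (T : Type) (op : T -> T -> T) (H G : set T) : Prop :=
  [/\ is_group op G, H `<=` G & is_group op H].

(* Main.v *)
(** Write [f = t u] with [u] of order 0.  Equality [[g,f] = (g',f')] gives
    [g' = g], [f = g f'] and [t f = g f'^2 = f f'] in columns 0, 1 and 2; as [u]
    is invertible the last equation forces [f' = t], and then [f = t g].  For
    the group structure, encode [[g, t u]] by the pair [(g, u)]: the product
    becomes [(g, u) (h, w) = (g + u (h - 1), u w)], with unit [(1, 1)] and
    inverse [(1 + u^-1 (1 - g), u^-1)], and the arrays [[g, t g]] are the
    diagonal pairs, on which it is the multiplication of series. *)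
Require Import Defs.
From mathcomp Require Import all_boot all_order all_algebra.
From mathcomp Require Import all_classical all_reals.
From mathcomp Require Import complex.

Local Open Scope classical_set_scope.
Local Open Scope ring_scope.

Import GRing.Theory.

Set Implicit Arguments.
Unset Strict Implicit.
Unset Printing Implicit Defensive.

(** * Formal power series: ring laws, multiplication by powers of [t], inverses *)

Section FpsTheory.
Variable K : fieldType.
Implicit Types (a b c : fps K) (n j : nat).

(** Coefficient [n] of a Cauchy product involves only indices up to [n], so truncations lose
    nothing; ring laws can thus be imported from polynomials. *)
Lemma fps_mul_poly a b N n : (n < N)%N ->
  fps_mul a b n = ((\poly_(i < N) a i) * (\poly_(i < N) b i))`_n.
Proof.
move=> ltnN; rewrite coefM; apply: eq_bigr => i _; rewrite !coef_poly.
by rewrite (leq_ltn_trans _ ltnN) ?leq_ord // (leq_ltn_trans _ ltnN) ?leq_subr.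
Qed.

Lemma fps_mulC a b : fps_mul a b = fps_mul b a.
Proof.
by apply/funext => n; rewrite !(fps_mul_poly _ _ (ltnSn n)) mulrC.
Qed.

Lemma fps_mulA a b c : fps_mul a (fps_mul b c) = fps_mul (fps_mul a b) c.
Proof.
apply/funext => n; pose P x : {poly K} := \poly_(i < n.+1) x i.
(* Both nested convolutions are coefficient [n] of the same triple product of truncations, bracketed
   differently. *)
transitivity ((P a * (P b * P c))`_n); last rewrite mulrA.
  rewrite coefM; apply: eq_bigr => i _.
  by rewrite -fps_mul_poly ?ltnS ?leq_subr // coef_poly ltn_ord.
rewrite coefM; apply: eq_bigr => i _.
by rewrite -fps_mul_poly // coef_poly ltnS leq_subr.
Qed.

Lemma fps_mulDr a b c : fps_mul a (b \+ c) = fps_mul a b \+ fps_mul a c.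
Proof.
apply/funext => n; rewrite /fps_mul /= -big_split /=.
by apply: eq_bigr => i _; rewrite mulrDr.
Qed.

Lemma fps_mulBr a b c : fps_mul a (b \- c) = fps_mul a b \- fps_mul a c.
Proof.
apply/funext => n; rewrite /fps_mul /= -sumrB.
by apply: eq_bigr => i _; rewrite mulrBr.
Qed.

Lemma fps_mul1l a : fps_mul (@fps1 K) a = a.
Proof.
apply/funext => n; rewrite /fps_mul big_ord_recl /= mul1r subn0.
by rewrite big1 ?addr0 // => i _; rewrite /fps1 mul0r.
Qed.

Lemma fps_mul1r a : fps_mul a (@fps1 K) = a.
Proof. by rewrite fps_mulC fps_mul1l. Qed.

Lemma fps_mul_coef0 a b : fps_mul a b 0 = a 0%N * b 0%N.
Proof. by rewrite /fps_mul big_ord1. Qed.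

Lemma fps_mulX_coef a n :
  fps_mul (@fpsX K) a n = if n is m.+1 then a m else 0.
Proof.
rewrite /fps_mul; case: n => [|n]; first by rewrite big_ord1 mul0r.
rewrite !big_ord_recl /= mul0r add0r mul1r subSS subn0.
by rewrite big1 ?addr0 // => i _; rewrite /fpsX mul0r.
Qed.

Lemma fps_mulX_inj : injective (fps_mul (@fpsX K)).
Proof.
move=> a b eqab; apply/funext => n.
by have := congr1 (fun c => c n.+1) eqab; rewrite !fps_mulX_coef.
Qed.

Lemma fps_expXM_coef j a n :
  fps_mul (fps_exp (@fpsX K) j) a n = if (j <= n)%N then a (n - j)%N else 0.
Proof.
elim: j n => [|j IHj] n; first by rewrite fps_mul1l subn0.
rewrite [fps_exp _ _]/= -fps_mulA fps_mulX_coef.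
by case: n => [|n] //; rewrite IHj ltnS subSS.
Qed.

Lemma fps_exp1 a : fps_exp a 1 = a.
Proof. exact: fps_mul1r. Qed.

Lemma fps_of_order1_mulX a :
  fps_of_order 1 a -> a = fps_mul (@fpsX K) (fun n => a n.+1).
Proof.
case=> a0 _; apply/funext => n; rewrite fps_mulX_coef.
by case: n => [|n] //; rewrite a0.
Qed.

Lemma fps_mulX_of_order1 a :
  a 0%N != 0 -> fps_of_order 1 (fps_mul (@fpsX K) a).
Proof. by move=> a0; split=> [[|i] //|]; rewrite fps_mulX_coef. Qed.

(** The convolution equation at index [n] determines coefficient [n] of the inverse from the earlier
    ones, after division by [a 0]. *)
Lemma fps_invertible a :
  a 0%N != 0 -> exists b, fps_mul a b = @fps1 K.
Proof.
move=> a0.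
(* [s n] carries the coefficients of the inverse below index [n]. *)
pose s := fix s n : fps K := if n is m.+1 then
    fun i => if i == m then
        (a 0%N)^-1 * (fps1 K m - \sum_(k < m) a k.+1 * s m (m - k.+1)%N)
      else s m i
  else fun=> 0.
(* Later stages never change an entry already computed, so the diagonal [s n.+1 n] gathers all of
   them into one series. *)
have s_stable n i : (i < n)%N -> s n i = s i.+1 i.
  elim: n => //= n IHn; rewrite ltnS leq_eqVlt => /predU1P[->|ltin].
    by rewrite eqxx.
  by rewrite (ltn_eqF ltin) IHn //= eqxx.
exists (fun n => s n.+1 n); apply/funext => n.
(* The term of index 0 is, by construction, [fps1 K n] minus the sum of the remaining terms. *)
rewrite /fps_mul big_ord_recl /= subn0 eqxx mulrA divff // mul1r.
rewrite [X in _ + X](eq_bigr (fun k : 'I_n => a k.+1 * s n (n - k.+1)%N)).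
  by rewrite subrK.
move=> k _; rewrite /bump add1n (s_stable n) //.
by rewrite subnS prednK ?subn_gt0 // leq_subr.
Qed.

End FpsTheory.

(** * Quasi-Riordan arrays as pairs of series, and their product *)

Section QuasiRiordan.
Variable K : fieldType.
Implicit Types (g h u w : fps K).

Local Notation t := (@fpsX K).
Local Notation one := (@fps1 K).

(** Column [k.+1] is [t^k (t u)], that is, [u] moved down by [k.+1] rows; the extra factor [t] makes
    the comparison strict. *)
Lemma quasi_riordan_coefS g u n k :
  quasi_riordan g (fps_mul t u) n k.+1 =
  if (k < n)%N then u (n - k.+1)%N else 0.
Proof.
rewrite /quasi_riordan fps_expXM_coef fps_mulX_coef.
case: ltngtP => [ltkn|//|->]; last by rewrite subnn.
by rewrite subnS; move: ltkn; rewrite -subn_gt0; case: (n - k)%N.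
Qed.

Lemma quasi_riordan_mul g u h w : h 0%N = 1 ->
  array_mul (quasi_riordan g (fps_mul t u)) (quasi_riordan h (fps_mul t w)) =
  quasi_riordan (g \+ fps_mul u (h \- one)) (fps_mul t (fps_mul u w)).
Proof.
move=> h0; apply/funext => n; apply/funext => k.
rewrite /array_mul big_ord_recl.
under eq_bigr do rewrite lift0 quasi_riordan_coefS.
case: k => [|k].
  rewrite /= h0 mulr1; congr (_ + _); case: n => [|n].
    by rewrite big_ord0 fps_mul_coef0 /= h0 subrr mulr0.
  (* Since [h - 1] has no constant term, the last term of the convolution drops out; reversing the
     order of summation then matches the matrix sum. *)
  rewrite /fps_mul [RHS]big_ord_recr /= subnn h0 subrr mulr0 addr0.
  rewrite [RHS](reindex_inj rev_ord_inj) /=; apply: eq_bigr => i _.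
  by rewrite ltn_ord subSS subSn ?leq_subr // subKn ?leq_ord //= subr0.
rewrite !quasi_riordan_coefS mulr0 add0r.
under eq_bigr do rewrite ltn_ord quasi_riordan_coefS.
case: ltnP => [ltkn|lenk]; last first.
  apply: big1 => i _; rewrite ltnS leqNgt.
  by rewrite (leq_trans (ltn_ord i) lenk) mulr0.
(* The right factor vanishes for [i < k]; removing these indices and shifting by [k] leaves
   coefficient [n - k.+1] of [w u]. *)
rewrite -(big_mkord xpredT (fun i => u (n - i.+1)%N *
  (if (k < i.+1)%N then w (i.+1 - k.+1)%N else 0))).
rewrite (big_cat_nat _ (ltnW ltkn)) //= big_nat big1 ?add0r; last first.
  by move=> i /= ltik; rewrite ltnS leqNgt ltik mulr0.
rewrite -{1}[k]add0n big_addn big_mkord fps_mulC /fps_mul -subSn // subSS.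
apply: eq_bigr => i _; rewrite ltnS leq_addl subSS addnK mulrC.
by rewrite -subnDA addnC.
Qed.

Lemma fps_of_order0 g : g 0%N = 1 -> fps_of_order 0 g.
Proof. by move=> g0; split=> //; rewrite g0 oner_neq0. Qed.

Lemma quasi_riordan_one :
  quasi_riordan_arrays (quasi_riordan one (fps_mul t one)).
Proof.
exists one, (fps_mul t one); split=> //; first exact: fps_of_order0.
by apply: fps_mulX_of_order1; rewrite oner_neq0.
Qed.

Lemma quasi_riordan_arraysP M :
  quasi_riordan_arrays M <->
  exists g u, [/\ g 0%N = 1, u 0%N != 0 & M = quasi_riordan g (fps_mul t u)].
Proof.
split=> [[g [f [_ g0 f1 ->]]]|[g [u [g0 u0 ->]]]].
  exists g, (fun n => f n.+1); split=> //; first by case: f1.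
  by rewrite -fps_of_order1_mulX.
exists g, (fps_mul t u); split=> //; first exact: fps_of_order0.
exact: fps_mulX_of_order1.
Qed.

Lemma quasi_appell_arraysP M :
  quasi_appell_arrays M <->
  exists g, g 0%N = 1 /\ M = quasi_riordan g (fps_mul t g).
Proof.
split=> [[g [_ g0 ->]]|[g [g0 ->]]]; first by exists g.
by exists g; split=> //; apply: fps_of_order0.
Qed.

(** On diagonal pairs the first component is [g + g (h - 1) = g h], equal to the second. *)
Lemma quasi_appell_mul g h : h 0%N = 1 ->
  array_mul (quasi_riordan g (fps_mul t g)) (quasi_riordan h (fps_mul t h)) =
  quasi_riordan (fps_mul g h) (fps_mul t (fps_mul g h)).
Proof.
move=> h0; rewrite quasi_riordan_mul //; congr quasi_riordan.
by rewrite fps_mulBr fps_mul1r; apply/funext => n /=; rewrite addrC subrK.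
Qed.

Lemma quasi_riordan_mul1l g u : g 0%N = 1 ->
  array_mul (quasi_riordan one (fps_mul t one)) (quasi_riordan g (fps_mul t u))
  = quasi_riordan g (fps_mul t u).
Proof.
move=> g0; rewrite quasi_riordan_mul // !fps_mul1l; congr quasi_riordan.
by apply/funext => n /=; rewrite addrC subrK.
Qed.

Lemma quasi_riordan_mul1r g u :
  array_mul (quasi_riordan g (fps_mul t u)) (quasi_riordan one (fps_mul t one))
  = quasi_riordan g (fps_mul t u).
Proof.
rewrite quasi_riordan_mul // fps_mulBr !fps_mul1r; congr quasi_riordan.
by apply/funext => n /=; rewrite subrr addr0.
Qed.

(** Both bracketings encode the pair [(g + u (h - 1) + u w (l - 1), u w m)]. *)
Lemma quasi_riordan_mulA g u h w l m : h 0%N = 1 -> l 0%N = 1 ->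
  let A := quasi_riordan g (fps_mul t u) in
  let B := quasi_riordan h (fps_mul t w) in
  let C := quasi_riordan l (fps_mul t m) in
  array_mul A (array_mul B C) = array_mul (array_mul A B) C.
Proof.
move=> h0 l0 A B C; rewrite /A /B /C.
rewrite !quasi_riordan_mul ?fps_mulA //; last first.
  by rewrite /= fps_mul_coef0 /= h0 l0 subrr mulr0 addr0.
congr quasi_riordan; rewrite -fps_mulA.
set x := fps_mul w _; rewrite !fps_mulBr fps_mulDr.
by apply/funext => n /=; rewrite -[in RHS]addrA [in LHS]addrAC.
Qed.

(** * The quasi-Riordan group and its subgroup of arrays [[g, t g]] *)

Lemma quasi_riordan_group : is_group (@array_mul K) (@quasi_riordan_arrays K).
Proof.
split=> [A B|A B C|].
- move=> /quasi_riordan_arraysP[g [u [g0 u0 ->]]].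
  move=> /quasi_riordan_arraysP[h [w [h0 w0 ->]]].
  rewrite quasi_riordan_mul //; apply/quasi_riordan_arraysP; do 2!eexists.
  split; last by [].
    by rewrite /= fps_mul_coef0 /= h0 subrr mulr0 addr0.
  by rewrite fps_mul_coef0 mulf_neq0.
- move=> /quasi_riordan_arraysP[g [u [g0 u0 ->]]].
  move=> /quasi_riordan_arraysP[h [w [h0 w0 ->]]].
  move=> /quasi_riordan_arraysP[l [m [l0 m0 ->]]].
  exact: quasi_riordan_mulA.
exists (quasi_riordan one (fps_mul t one)).
split; first exact: quasi_riordan_one.
  move=> _ /quasi_riordan_arraysP[g [u [g0 u0 ->]]].
  by rewrite quasi_riordan_mul1l // quasi_riordan_mul1r.
move=> _ /quasi_riordan_arraysP[g [u [g0 u0 ->]]].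
have [v uv] := fps_invertible u0.
have v0 : v 0%N != 0.
  have := congr1 (fun c => c 0%N) uv; rewrite fps_mul_coef0 => /eqP.
  by apply: contraTneq => ->; rewrite mulr0 eq_sym oner_neq0.
(* This solves [h + v (g - 1) = 1], the first component of the left inverse equation. *)
pose h : fps K := one \+ fps_mul v (one \- g).
have h0 : h 0%N = 1 by rewrite /h /= fps_mul_coef0 /= g0 subrr mulr0 addr0.
exists (quasi_riordan h (fps_mul t v)); split.
- by apply/quasi_riordan_arraysP; exists h, v.
- rewrite quasi_riordan_mul // (fps_mulC v u) uv; congr quasi_riordan.
  rewrite /h !fps_mulBr; apply/funext => n /=.
  by rewrite -addrA subrKA subrr addr0.
rewrite quasi_riordan_mul // uv; congr quasi_riordan.
have -> : h \- one = fps_mul v (one \- g).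
  by apply/funext => n; rewrite /h /= addrC addKr.
by rewrite fps_mulA uv fps_mul1l; apply/funext => n /=; rewrite addrC subrK.
Qed.

Lemma quasi_appell_subset : @quasi_appell_arrays K `<=` @quasi_riordan_arrays K.
Proof.
move=> _ /quasi_appell_arraysP[g [g0 ->]]; apply/quasi_riordan_arraysP.
by exists g, g; rewrite g0 oner_neq0.
Qed.

Lemma quasi_appell_group : is_group (@array_mul K) (@quasi_appell_arrays K).
Proof.
have [_ mulA _] := quasi_riordan_group; split=> [A B|A B C HA HB HC|].
- move=> /quasi_appell_arraysP[g [g0 ->]] /quasi_appell_arraysP[h [h0 ->]].
  rewrite quasi_appell_mul //; apply/quasi_appell_arraysP.
  by exists (fps_mul g h); rewrite fps_mul_coef0 g0 h0 mulr1.
- by apply: mulA; apply: quasi_appell_subset.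
exists (quasi_riordan one (fps_mul t one)); split.
- by apply/quasi_appell_arraysP; exists one.
- move=> _ /quasi_appell_arraysP[g [g0 ->]].
  by rewrite quasi_riordan_mul1l // quasi_riordan_mul1r.
move=> _ /quasi_appell_arraysP[g [g0 ->]].
have [|h gh] := @fps_invertible _ g; first by rewrite g0 oner_neq0.
have h0 : h 0%N = 1.
  by have := congr1 (fun c => c 0%N) gh; rewrite fps_mul_coef0 g0 mul1r.
exists (quasi_riordan h (fps_mul t h)).
rewrite !quasi_appell_mul // (fps_mulC h g) gh; split=> //.
by apply/quasi_appell_arraysP; exists h.
Qed.

(** * Comparison with Riordan arrays *)

Lemma quasi_riordan_appellE g : quasi_riordan g (fps_mul t g) = riordan g t.
Proof.
apply/funext => n; apply/funext => -[|k]; first by rewrite /riordan fps_mul1r.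
by rewrite /quasi_riordan /riordan fps_mulA (fps_mulC _ t) fps_mulC.
Qed.

Lemma quasi_riordan_riordan g f : fps_of_order 1 f ->
  riordan_arrays (quasi_riordan g f) -> f = fps_mul t g.
Proof.
move=> f1 [g' [f' [_ _ eqM]]].
have col k : (fun n => quasi_riordan g f n k) = fps_mul g' (fps_exp f' k).
  by rewrite eqM.
have eq_g : g = g' by have := col 0; rewrite fps_mul1r.
have eq_f : f = fps_mul g f'.
  by have := col 1; rewrite fps_exp1 -eq_g => <-; apply/esym/fps_mul1l.
have eq_tf : fps_mul t f = fps_mul f f'.
  have := col 2; rewrite -eq_g [fps_exp f' 2]/= fps_mul1r fps_mulA -eq_f => <-.
  by apply/funext => n; rewrite /= fps_mul1r.
suff -> : t = f' by rewrite fps_mulC.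
have [v uv] := @fps_invertible _ (fun n => f n.+1) f1.2.
move: eq_tf; rewrite (fps_of_order1_mulX f1).
(* The equation is now [t (t u) = t u f']; cancelling [t] gives [t u = u f'], and multiplying by the
   inverse [v] of [u] isolates [f']. *)
set u := fun n => f n.+1 in uv *; rewrite -fps_mulA => /fps_mulX_inj eq_tu.
have := congr1 (fps_mul v) eq_tu.
by rewrite (fps_mulC t) !fps_mulA (fps_mulC v u) uv !fps_mul1l.
Qed.

End QuasiRiordan.

Theorem theorem3p3 (R : realType) (s : scalars) :
  let K := scalar_field R s in
  (forall g f : fps K,
     fps_of_order 0 g -> g 0%N = 1 -> fps_of_order 1 f ->
     (riordan_arrays (quasi_riordan g f) <-> f = fps_mul (@fpsX K) g) /\
     (f = fps_mul (@fpsX K) g -> quasi_riordan g f = riordan g (@fpsX K))) /\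
  is_subgroup (@array_mul K) (@quasi_appell_arrays K) (@quasi_riordan_arrays K).
Proof.
move=> K; split=> [g f g_ord g0 f_ord|].
  split=> [|->]; last exact: quasi_riordan_appellE.
  split=> [|eq_f]; first exact: quasi_riordan_riordan.
  exists g, (@fpsX K); split=> //; last by rewrite eq_f quasi_riordan_appellE.
  by rewrite -[fpsX _]fps_mul1r; apply: fps_mulX_of_order1; rewrite oner_neq0.
split; [exact: quasi_riordan_group | exact: quasi_appell_subset |].
exact: quasi_appell_group.
Qed.
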